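(* Let $\mathfrak g$ be a finite-dimensional real vector space with inner product $\bar g$ and let $\bar{\mathcal G}=\mathcal G(\bar g,0)$. For every Dorfman bracket $\boldsymbol\mu\in\mathcal D$ with Lie bracket $\mu=\boldsymbol\mu_{\mathfrak g}$ and 3-form $H=\boldsymbol\mu_{\Lambda^3}$, the generalized Ricci curvature and the moment map for the action of $\mathsf L$ on Dorfman brackets are related by $$\mathcal Rc_{\boldsymbol\mu}=\mathrm M_{\boldsymbol\mu}+\overline{\operatorname{Ric}_\mu}-\overline{\mathrm M_\mu}+A_{\boldsymbol\mu}$$ for some $A_{\boldsymbol\mu}\in\mathfrak{so}(\mathfrak g\oplus\mathfrak g^*,\bar{\mathcal G})\cap\mathfrak{so}(\mathfrak g\oplus\mathfrak g^*,\langle\cdot,\cdot\rangle)$.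
   Context: $\langle X+\xi,Y+\eta\rangle=\frac12(\xi(Y)+\eta(X))$ on $\mathfrak g\oplus\mathfrak g^*$; $\bar{\mathcal G}=\mathcal G(\bar g,0)=\begin{pmatrix}0&\bar g^{-1}\\ \bar g&0\end{pmatrix}$. $\mathfrak{so}(\mathfrak g\oplus\mathfrak g^*,\bar{\mathcal G})$ denotes the endomorphisms that are skew for $\langle\bar{\mathcal G}\cdot,\cdot\rangle$. For $F\in\mathfrak{gl}(\mathfrak g)$, $\overline F:=\begin{pmatrix}F&0\\0&-F^*\end{pmatrix}$. $\mathcal D$ is the set of brackets $\boldsymbol\mu(X+\xi,Y+\eta)=\mu(X,Y)-\eta\circ\mu(X,\cdot)+\xi\circ\mu(Y,\cdot)+\iota_Y\iota_XH$ with $\mu$ a Lie bracket on $\mathfrak g$ and $H\in\Lambda^3\mathfrak g^*$ closed, $\mathrm d_\mu H=0$ ($\mathrm d_\mu$ the Chevalley–Eilenberg differential); one writes $\boldsymbol\mu_{\mathfrak g}=\mu$, $\boldsymbol\mu_{\Lambda^3}=H$. Inner products (with $\{e_i\}$ a $\bar g$-orthonormal basis, $\{e^i\}$ its dual basis): $\bar g(\mu,\nu)=\sum_{i,j}\bar g(\mu(e_i,e_j),\nu(e_i,e_j))$ on $\Lambda^2\mathfrak g^*\otimes\mathfrak g$; $\bar g(\alpha,\beta)=\sum_{i_1,\dots,i_k}\alpha_{i_1\cdots i_k}\beta_{i_1\cdots i_k}$ on $\Lambda^k\mathfrak g^*$ (sum over all indices); $\bar g(A,B)=\operatorname{tr}AB^T$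 on $\mathfrak{gl}(\mathfrak g)$; on $\Lambda^2(\mathfrak g\oplus\mathfrak g^* )^*\otimes(\mathfrak g\oplus\mathfrak g^* )$, $$\bar g(\boldsymbol\mu,\boldsymbol\nu)=2\sum_{i,j}\langle\bar{\mathcal G}\boldsymbol\mu(e_i,e_j),\boldsymbol\nu(e_i,e_j)\rangle+4\sum_{i,j}\langle\bar{\mathcal G}\boldsymbol\mu(e_i,e^j),\boldsymbol\nu(e_i,e^j)\rangle+2\sum_{i,j}\langle\bar{\mathcal G}\boldsymbol\mu(e^i,e^j),\boldsymbol\nu(e^i,e^j)\rangle .$$ $\mathsf L=\left\{\begin{pmatrix}\mathrm{Id}&0\\ b&\mathrm{Id}\end{pmatrix}\begin{pmatrix}h&0\\0&(h^{-1})^*\end{pmatrix}:h\in\mathsf{GL}(\mathfrak g),b\in\Lambda^2\mathfrak g^*\right\}$ acts on brackets by $\ell\cdot\boldsymbol\mu=\ell\boldsymbol\mu(\ell^{-1}\cdot,\ell^{-1}\cdot)$; its Lie algebra is $\mathfrak l=\left\{\begin{pmatrix}A&0\\ \alpha&-A^*\end{pmatrix}:A\in\mathfrak{gl}(\mathfrak g),\alpha\in\Lambda^2\mathfrak g^*\right\}$, with infinitesimal action $\Theta(L)\boldsymbol\mu=L\boldsymbol\mu(\cdot,\cdot)-\boldsymbol\mu(L\cdot,\cdot)-\boldsymbol\mu(\cdot,L\cdot)$ and inner product $$\bar g_{\mathfrak l}\left(\begin{pmatrix}A&0\\ \alpha&-A^*\end{pmatrix},\begin{pmatrix}B&0\\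 \beta&-B^*\end{pmatrix}\right)=2\operatorname{tr}AB^T+\tfrac16\sum_{i,j}\alpha_{ij}\beta_{ij}.$$ The moment map $\mathrm M_{\boldsymbol\mu}\in\mathfrak l$ is defined by $\bar g_{\mathfrak l}(\mathrm M_{\boldsymbol\mu},L)=\frac16\bar g(\Theta(L)\boldsymbol\mu,\boldsymbol\mu)$ for all $L\in\mathfrak l$. The moment map $\mathrm M_\mu\in\operatorname{End}(\mathfrak g)$ is defined by $\bar g(\mathrm M_\mu,A)=\frac14\bar g(\theta(A)\mu,\mu)$ for all $A\in\mathfrak{gl}(\mathfrak g)$, with $\theta(A)\mu=A\mu(\cdot,\cdot)-\mu(A\cdot,\cdot)-\mu(\cdot,A\cdot)$. $\operatorname{Ric}_\mu\in\operatorname{End}(\mathfrak g)$ is the Ricci endomorphism of the left-invariant metric defined by $\bar g$ on the simply connected Lie group $\mathsf G_\mu$ with Lie algebra $(\mathfrak g,\mu)$. $\mathcal Rc_{\boldsymbol\mu}\in\operatorname{End}(\mathfrak g\oplus\mathfrak g^* )$ is the generalized Ricci curvature, at the identity, of the left-invariant exact Courant algebroid over $\mathsf G_\mu$ with Dorfman bracket $\boldsymbol\mu$ and generalized metric $\bar{\mathcal G}$; explicitly $$\mathcal Rc_{\boldsymbol\mu}=\begin{pmatrix}\operatorname{Ric}^B_{\mu,H}&\frac12\bar g^{-1}(\mathrm d_\mu^*H)\bar g^{-1}\\ -\frac12\mathrm d^*_\mu H&-(\operatorname{Ric}^B_{\mu,H})^*\end{pmatrix},\qquad\operatorname{Ric}^B_{\mu,H}=\operatorname{Ric}_\mu-\tfrac14\bar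 g^{-1}H^2,$$ where $H^2(X,Y)=\bar g(\iota_XH,\iota_YH)$, $\mathrm d_\mu^*H$ is the codifferential of the left-invariant 3-form $H$ on $\mathsf G_\mu$ with respect to the left-invariant metric $\bar g$, and 2-forms are viewed as maps $\mathfrak g\to\mathfrak g^*$.
   Formalization: The codifferential of H in the generalized Ricci curvature is replaced by the adjoint of d_μ on left-invariant forms for the all-index inner products (3 times the usual one if μ is unimodular, else off by a tr ad term); with the usual one the identity fails, e.g. on h_3+R with H=e^{124}. *)

(* Defs.v *)
From HB Require Import structures.
From mathcomp Require Import all_boot all_order all_algebra.
From mathcomp Require Import all_classical reals.

Set Implicit Arguments.
Unset Strict Implicit.
Unset Printing Implicit Defensive.

Import Order.TTheory GRing.Theory Num.Theory.

Local Open Scope ring_scope.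

(* The dual space V^* and the generalized tangent space V (+) V^*. *)
Notation dual V := 'Hom(V, (_^o)%type).
Notation gentan V := (V * dual V)%type.

Section Linear.
Variables (R : realType) (V : vectType R) (g : {dot V for idfun}).

(* F^* : xi |-> xi o F *)
Definition dual_map (F : 'End(V)) : 'End(dual V) :=
  linfun (fun xi : dual V => (xi \o F)%VF).

(* An element b of 'Hom(V, V^* ) doubles as the bilinear form
   (X, Y) |-> b X Y; a 2-form is such a map which is alternating, so that it is
   viewed as the map X |-> iota_X b. *)
Definition two_form (b : 'Hom(V, dual V)) : Prop := forall X, b X X = 0.

Definition block (a : 'End(V)) (b : 'Hom(dual V, V)) (c : 'Hom(V, dual V))
    (d : 'End(dual V)) : 'End(gentan V) :=
  linfun (fun u : gentan V => (a u.1 + b u.2, c u.1 + d u.2) : gentan V).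

Definition overline (F : 'End(V)) : 'End(gentan V) :=
  block F 0 0 (- dual_map F).

Definition pairing (u v : gentan V) : R := 2^-1 * (u.2 v.1 + v.2 u.1).

(* The metric as a map V -> V^*, X |-> g(X, .), and its inverse. *)
Definition flat : 'Hom(V, dual V) :=
  linfun (fun X => linfun (fun Y => g X Y : R^o)).
Definition sharp : 'Hom(dual V, V) := (flat^-1)%VF.

(* The generalized metric G(g, 0). *)
Definition Gbar : 'End(gentan V) := block 0 sharp flat 0.

Definition so_Gbar (A : 'End(gentan V)) : Prop :=
  forall u v, pairing (Gbar (A u)) v = - pairing (Gbar u) (A v).

Definition so_pairing (A : 'End(gentan V)) : Prop :=
  forall u v, pairing (A u) v = - pairing u (A v).

Definition trace (F : 'End(V)) : R :=
  \tr (passmx.mxof (vbasis {:V}) (vbasis {:V}) F).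

(* The g-transpose of an endomorphism. *)
Definition transpose (F : 'End(V)) : 'End(V) :=
  (sharp \o dual_map F \o flat)%VF.

End Linear.

Section Brackets.
Variables (R : realType) (V : vectType R).

Definition lie_bracket (mu : V -> V -> V) : Prop :=
  [/\ bilinear_for *:%R *:%R mu,
      forall X, mu X X = 0
    & forall X Y Z, mu X (mu Y Z) + mu Y (mu Z X) + mu Z (mu X Y) = 0].

Definition three_form (H : V -> V -> V -> R) : Prop :=
  [/\ forall X, bilinear_for *%R *%R (H X),
      forall Y Z, linear_for *%R (fun X => H X Y Z),
      forall X Y, H X X Y = 0
    & forall X Y, H X Y Y = 0].

(* The Chevalley-Eilenberg differential
   (d_mu w)(X_0, ..., X_k)
     = \sum_(i < j) (-1)^(i + j) w([X_i, X_j], X_0, ..^i..^j.., X_k)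
   on 2-forms and on 3-forms. *)
Definition CE2 (mu : V -> V -> V) (a : 'Hom(V, dual V)) (X Y Z : V) : R :=
  - a (mu X Y) Z + a (mu X Z) Y - a (mu Y Z) X.

Definition CE3 (mu : V -> V -> V) (H : V -> V -> V -> R) (X Y Z W : V) : R :=
  - H (mu X Y) Z W + H (mu X Z) Y W - H (mu X W) Y Z
  - H (mu Y Z) X W + H (mu Y W) X Z - H (mu Z W) X Y.

Definition dorfman (mu : V -> V -> V) (H : V -> V -> V -> R)
    (u v : gentan V) : gentan V :=
  (mu u.1 v.1,
   linfun (fun Z => - v.2 (mu u.1 Z) + u.2 (mu v.1 Z) + H u.1 v.1 Z : R^o)).

Definition Dbrackets : set (gentan V -> gentan V -> gentan V) :=
  [set bmu | exists mu H, [/\ lie_bracket mu, three_form H,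
     forall X Y Z W, CE3 mu H X Y Z W = 0 & bmu = dorfman mu H]]%classic.

(* The components of a bracket on g (+) g^* giving mu and H. *)
Definition part_g (bmu : gentan V -> gentan V -> gentan V) (X Y : V) : V :=
  (bmu (X, 0) (Y, 0)).1.

Definition part_L3 (bmu : gentan V -> gentan V -> gentan V) (X Y Z : V) : R :=
  (bmu (X, 0) (Y, 0)).2 Z.

Definition theta (A : 'End(V)) (mu : V -> V -> V) (X Y : V) : V :=
  A (mu X Y) - mu (A X) Y - mu X (A Y).

Definition Theta (L : 'End(gentan V)) (bmu : gentan V -> gentan V -> gentan V)
    (u v : gentan V) : gentan V :=
  L (bmu u v) - bmu (L u) v - bmu u (L v).

(* The lower-triangular blocks (A, alpha) of an endomorphism of g (+) g^*. *)
Definition blockA (L : 'End(gentan V)) : 'End(V) :=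
  linfun (fun X => (L (X, 0)).1).
Definition blockalpha (L : 'End(gentan V)) : 'Hom(V, dual V) :=
  linfun (fun X => (L (X, 0)).2).

(* The Lie algebra of the group of transformations e^b h. *)
Definition lie_l (L : 'End(gentan V)) : Prop :=
  two_form (blockalpha L) /\
  L = block (blockA L) 0 (blockalpha L) (- dual_map (blockA L)).

End Brackets.

(* Quantities attached to the metric g. Those expressed by components take a
   basis e, meant to be g-orthonormal; its dual basis is coord e. *)
Section Metric.
Variables (R : realType) (V : vectType R) (g : {dot V for idfun}).
Variables (n : nat) (e : n.-tuple V).

Definition orthonormal_basis : bool := basis_of {:V} e && orthonormal g e.

Definition evec (i : 'I_n) : gentan V := (e`_i, 0).
Definition ecov (i : 'I_n) : gentan V := (0, linfun (coord e i : V -> R^o)).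

Definition ip_bracket (mu nu : V -> V -> V) : R :=
  \sum_(i < n) \sum_(j < n) g (mu e`_i e`_j) (nu e`_i e`_j).

Definition ip_dorfman (bmu bnu : gentan V -> gentan V -> gentan V) : R :=
    2 * (\sum_(i < n) \sum_(j < n)
      pairing (Gbar g (bmu (evec i) (evec j))) (bnu (evec i) (evec j)))
  + 4 * (\sum_(i < n) \sum_(j < n)
      pairing (Gbar g (bmu (evec i) (ecov j))) (bnu (evec i) (ecov j)))
  + 2 * (\sum_(i < n) \sum_(j < n)
      pairing (Gbar g (bmu (ecov i) (ecov j))) (bnu (ecov i) (ecov j))).

(* On forms the sums run over all indices, with no 1/k! factor. *)
Definition ip_form2 (a b : V -> V -> R) : R :=
  \sum_(i < n) \sum_(j < n) a e`_i e`_j * b e`_i e`_j.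

Definition ip_form3 (a b : V -> V -> V -> R) : R :=
  \sum_(i < n) \sum_(j < n) \sum_(k < n)
    a e`_i e`_j e`_k * b e`_i e`_j e`_k.

Definition ip_gl (A B : 'End(V)) : R := trace (A \o transpose g B)%VF.

Definition ip_l (L L' : 'End(gentan V)) : R :=
  2 * trace (blockA L \o transpose g (blockA L'))%VF
  + 6^-1 * ip_form2 (fun X => blockalpha L X) (fun X => blockalpha L' X).

(* The moment maps are the Riesz representatives of linear functionals,
   selected by [xget] through their defining property. *)
Definition moment (mu : V -> V -> V) : 'End(V) :=
  xget 0 [set M | forall A : 'End(V),
    ip_gl M A = 4^-1 * ip_bracket (theta A mu) mu]%classic.

Definition gmoment (bmu : gentan V -> gentan V -> gentan V) :
    'End(gentan V) :=
  xget 0 [set M | lie_l M /\ forall L, lie_l L ->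
    ip_l M L = 6^-1 * ip_dorfman (Theta L bmu) bmu]%classic.

(* The codifferential d_mu^* on 3-forms: the adjoint of d_mu with respect to
   the inner products ip_form2 and ip_form3. Two points depend on this choice.
   As these inner products carry no 1/k!, for unimodular mu the result is
   3 times - \sum_i iota_(e_i) nabla_(e_i) H. For non-unimodular mu the adjoint
   on left-invariant forms differs from the L^2 adjoint by a term in tr ad. *)
Definition codiff (mu : V -> V -> V) (H : V -> V -> V -> R) :
    'Hom(V, dual V) :=
  xget 0 [set b | two_form b /\ forall a : 'Hom(V, dual V), two_form a ->
    ip_form2 (fun X => a X) (fun X => b X) = ip_form3 (CE2 mu a) H]%classic.

(* Levi-Civita connection on left-invariant fields, by the Koszul formula. *)
Definition nabla (mu : V -> V -> V) (X Y : V) : V :=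
  sharp g (linfun (fun Z =>
    2^-1 * (g (mu X Y) Z - g (mu Y Z) X + g (mu Z X) Y) : R^o)).

Definition riemann (mu : V -> V -> V) (X Y Z : V) : V :=
  nabla mu X (nabla mu Y Z) - nabla mu Y (nabla mu X Z) - nabla mu (mu X Y) Z.

Definition ricci_form (mu : V -> V -> V) (Y Z : V) : R :=
  trace (linfun (fun X => riemann mu X Y Z)).

Definition Ric (mu : V -> V -> V) : 'End(V) :=
  linfun (fun Y => sharp g (linfun (fun Z => ricci_form mu Y Z : R^o))).

(* H^2(X, Y) = g(iota_X H, iota_Y H) as a map V -> V^*. *)
Definition Hsq (H : V -> V -> V -> R) : 'Hom(V, dual V) :=
  linfun (fun X => linfun (fun Y => ip_form2 (H X) (H Y) : R^o)).

Definition RicB (mu : V -> V -> V) (H : V -> V -> V -> R) : 'End(V) :=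
  Ric mu - 4^-1 *: (sharp g \o Hsq H)%VF.

Definition gRic (bmu : gentan V -> gentan V -> gentan V) : 'End(gentan V) :=
  let mu := part_g bmu in
  let H := part_L3 bmu in
  block (RicB mu H)
        (2^-1 *: (sharp g \o codiff mu H \o sharp g)%VF)
        (- (2^-1 *: codiff mu H))
        (- dual_map (RicB mu H)).

End Metric.

(* Main.v *)
From HB Require Import structures.
Require Import Defs.
From mathcomp Require Import all_boot all_order all_algebra.
From mathcomp Require Import all_classical reals.
From mathcomp Require Import ring.
Import GRing.Theory Num.Theory.
Local Open Scope ring_scope.

Set Implicit Arguments.
Unset Strict Implicit.
Unset Printing Implicit Defensive.

(** Riesz duality makes the [xget] choices defining the moment map and the
    codifferential satisfy their defining properties.  Expanding in an orthonormal basis, for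
    L = [A, 0; a, -A^*],
      g(Theta(L) bmu, bmu)
        = 3 g(theta(A) mu, mu) - g(d_mu a, H) - 3 g(H(A., ., .), H),
    and the three terms are Riesz-represented by M_mu, d_mu^* H and H^2.  As
    ip_l is positive definite on l, the generalized moment map is
      [M_mu - H^2/4, 0; - d_mu^* H, - (M_mu - H^2/4)^*].
    Its difference from the generalized Ricci curvature, once Ric_mu and M_mu
    are exchanged, has the off-diagonal blocks g^-1 (d_mu^* H) g^-1 / 2 and
    (d_mu^* H)/2, which is skew for both pairings because d_mu^* H is a 2-form. *)

(** * Linear functionals, Riesz representation and the trace *)

Section LinearAlgebra.
Variable R : realType.

(** [lfunE] expects a bundled linear map, while the maps under [linfun] in the definitions are bare
    functions. Their linearity is supplied here as a hypothesis and bundled on the spot. *)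
Lemma linfunE (U W : vectType R) (f : U -> W) : linear f -> linfun f =1 f.
Proof.
move=> lin_f x.
pose f' : {linear U -> W} :=
  HB.pack f (GRing.isLinear.Build R U W *:%R f lin_f).
exact: (lfunE f').
Qed.

Lemma dualfunE (U : vectType R) (f : U -> R) :
  linear_for *%R f -> linfun (f : U -> R^o) =1 f.
Proof. exact: (@linfunE U R^o f). Qed.

Lemma dualP (U : vectType R) (xi : dual U) : linear_for *%R (xi : U -> R).
Proof. by move=> a X Y; rewrite linearP. Qed.

Lemma dualB (U : vectType R) (xi : dual U) X Y : xi (X - Y) = xi X - xi Y :> R.
Proof. exact: (linearB xi). Qed.

Lemma dim_dual (U : vectType R) : \dim {: dual U} = \dim {:U}.
Proof. by rewrite !dimvf /dim /= muln1. Qed.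

Lemma lker0_dual_limgf (U : vectType R) (f : 'Hom(U, dual U)) :
  lker f == 0%VS -> limg f = fullv.
Proof.
move=> kerf; apply/eqP; rewrite eqEdim subvf dim_dual limg_dim_eq //=.
by rewrite (eqP kerf) capv0.
Qed.

Lemma definite_lker0 (U : vectType R) (B : 'Hom(U, dual U)) :
  (forall x, B x x = 0 -> x = 0) -> lker B == 0%VS.
Proof.
move=> defB; rewrite -subv0; apply/subvP => x; rewrite memv_ker memv0 => /eqP Bx.
by apply/eqP/defB; rewrite Bx lfunE.
Qed.

(** Definiteness makes x |-> B(x, .) injective from U to its dual, hence onto by equality of
    dimensions. This gives existence for both the moment map and the codifferential. *)
Lemma riesz (U : vectType R) (B : U -> U -> R) (f : U -> R) :
  (forall y, linear_for *%R (B^~ y)) -> (forall x, linear_for *%R (B x)) ->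
  (forall x, B x x = 0 -> x = 0) -> linear_for *%R f ->
  exists x, forall y, B x y = f y.
Proof.
move=> linl linr defB linf.
pose b : 'Hom(U, dual U) := linfun (fun x => linfun (B x : U -> R^o)).
have bE x y : b x y = B x y.
  rewrite /b linfunE ?(dualfunE (linr x)) // => a x1 x2; apply/lfunP => z.
  by rewrite add_lfunE scale_lfunE !(dualfunE (linr _)) linl.
have /lker0_dual_limgf limb : lker b == 0%VS.
  by apply: definite_lker0 => x; rewrite bE; apply: defB.
have /memv_imgP[x _ bx] : linfun (f : U -> R^o) \in limg b by rewrite limb memvf.
by exists x => y; rewrite -bE -bx (dualfunE linf).
Qed.

(** [trace] is computed in [vbasis]. Writing F as 1 o F o 1, with [e] as the outer bases and
    [vbasis] as the inner ones, gives a conjugation by change-of-basis matrices, which cancels under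
    the cyclic property of [\tr]. *)
Lemma trace_basis (V : vectType R) n (e : n.-tuple V) (F : 'End(V)) :
  basis_of {:V} e -> trace F = \sum_(i < n) coord e i (F e`_i).
Proof.
move=> eb; have Dn : n = \dim {:V} by rewrite -(size_basis eb).
subst n; have vb := vbasisP {:V}.
have -> : trace F = \tr (passmx.mxof e e F).
  rewrite -[in RHS](comp_lfun1l F) -[in RHS](comp_lfun1r (\1 \o F)%VF).
  rewrite (passmx.mxof_comp e e vb) (passmx.mxof_comp _ e vb).
  rewrite mxtrace_mulC -mulmxA -(passmx.mxof_comp _ _ eb) comp_lfun1r.
  by rewrite passmx.mxof1 ?mulmx1 ?(basis_free vb).
by apply: eq_bigr => i _; rewrite !mxE /= passmx.vecof_delta.
Qed.

(** * Musical isomorphisms, the generalized metric and block endomorphisms *)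

Section Metric.
Variables (V : vectType R) (g : {dot V for idfun}).

Lemma dotC X Y : g X Y = g Y X.
Proof. by rewrite hermC /= expr0 mul1r. Qed.

Lemma dot_eq0 X : g X X = 0 -> X = 0.
Proof.
by move=> gX; apply/eqP/negPn/negP => /(neq0_dnorm_gt0 (s := g)); rewrite gX Order.POrderTheory.ltxx.
Qed.

Lemma dot_ge0 X : 0 <= g X X.
Proof.
have [->|/(neq0_dnorm_gt0 (s := g))/Order.POrderTheory.ltW//] := eqVneq X 0.
by rewrite linear0r.
Qed.

Lemma dot_linear X : linear_for *%R (g X).
Proof. by move=> a Y1 Y2; rewrite linearPr. Qed.

Lemma dotPl a X1 X2 Y : g (a *: X1 + X2) Y = a * g X1 Y + g X2 Y.
Proof. by rewrite linearPl. Qed.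

Lemma flatE X Y : flat g X Y = g X Y.
Proof.
rewrite /flat linfunE => [|a X1 X2]; first by rewrite (dualfunE (dot_linear X)).
apply/lfunP => Z; rewrite !lfunE /= lfunE /=.
by rewrite !(dualfunE (dot_linear _)) dotPl.
Qed.

Lemma flat_lker0 : lker (flat g) == 0%VS.
Proof. by apply: definite_lker0 => X; rewrite flatE; apply: dot_eq0. Qed.

(** The inverse of a linear map is a right inverse only on its image. The image of [flat] is the
    whole dual, since [flat] is injective and the dimensions agree. *)
Lemma sharpK : cancel (sharp g) (flat g).
Proof.
by move=> xi; rewrite limg_lfunVK // (lker0_dual_limgf flat_lker0) memvf.
Qed.

Lemma dot_sharp xi Y : g (sharp g xi) Y = xi Y.
Proof. by rewrite -flatE sharpK. Qed.

Lemma blockE a b c d (u : gentan V) :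
  block a b c d u = (a u.1 + b u.2, c u.1 + d u.2).
Proof.
rewrite /block linfunE // => k x y /=.
by apply: injective_projections; rewrite /= !linearP /= scalerDr addrACA.
Qed.

Lemma sharpC (xi eta : dual V) : xi (sharp g eta) = eta (sharp g xi).
Proof. by rewrite -dot_sharp dotC dot_sharp. Qed.

(** The basis-free form, used to check skewness at the end; [pairing_Gbar] is the version in
    components, used for the sums over a basis. *)
Lemma pairing_Gbar_sharp (u v : gentan V) : pairing (Gbar g u) v =
  2^-1 * (g u.1 v.1 + g (sharp g u.2) (sharp g v.2)).
Proof.
rewrite /pairing /Gbar blockE /= add_lfunE !zero_lfunE add0r addr0 flatE.
by rewrite [in RHS](dotC (sharp g u.2)) dot_sharp.
Qed.

Lemma dual_mapE (F : 'End(V)) (xi : dual V) X : dual_map F xi X = xi (F X).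
Proof.
rewrite /dual_map linfunE ?lfunE // => a x y.
by rewrite comp_lfunDl comp_lfunZl.
Qed.

Lemma transposeE (F : 'End(V)) X Y : g (transpose g F X) Y = g X (F Y).
Proof. by rewrite /transpose !lfunE /= lfunE /= dot_sharp dual_mapE flatE. Qed.

Lemma blockD a b c d a' b' c' d' :
  block a b c d + block a' b' c' d' =
  block (a + a') (b + b') (c + c') (d + d') :> 'End(gentan V).
Proof.
apply/lfunP => u; rewrite add_lfunE !blockE.
by apply: injective_projections; rewrite /= !add_lfunE addrACA.
Qed.

Lemma blockN a b c d :
  - (block a b c d : 'End(gentan V)) = block (- a) (- b) (- c) (- d).
Proof.
apply/lfunP => u; rewrite opp_lfunE [in LHS]blockE blockE.
by apply: injective_projections; rewrite /= !opp_lfunE opprD.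
Qed.

Lemma dual_mapD : {morph @dual_map R V : F G / F + G}.
Proof.
move=> F G; apply/lfunP => xi; apply/lfunP => X.
by rewrite !add_lfunE !dual_mapE add_lfunE linearD.
Qed.

Lemma dual_mapN : {morph @dual_map R V : F / - F}.
Proof.
move=> F; apply/lfunP => xi; apply/lfunP => X.
by rewrite !opp_lfunE !dual_mapE opp_lfunE linearN.
Qed.

Lemma blockA_block A b a d : blockA (block A b a d : 'End(gentan V)) = A.
Proof.
apply/lfunP => X; rewrite /blockA linfunE ?blockE /= ?linear0 ?addr0 //.
by move=> k X1 X2; rewrite !blockE /= !linear0 !addr0 linearP.
Qed.

Lemma blockalpha_block A b a d :
  blockalpha (block A b a d : 'End(gentan V)) = a.
Proof.
apply/lfunP => X; rewrite /blockalpha linfunE ?blockE /= ?linear0 ?addr0 //.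
by move=> k X1 X2; rewrite !blockE /= !linear0 !addr0 linearP.
Qed.

(** * Expansions in an orthonormal basis *)

Section Orthonormal.
Variables (n : nat) (e : n.-tuple V) (he : orthonormal_basis g e).

Let e_basis : basis_of {:V} e. Proof. by case/andP: he. Qed.

Lemma pair_ortho_nth (s : seq V) i j : pair_ortho_rec g s ->
  (i < j < size s)%N -> g s`_i s`_j = 0.
Proof.
elim: s i j => [|x s IHs] [|i] [|j] //=; rewrite ?andbF // => /andP[].
  by rewrite /= andbT => /allP xs _ /= js; apply/eqP/xs/mem_nth.
by move=> _ /IHs; apply.
Qed.

Lemma orthonormal_nth (i j : 'I_n) : g e`_i e`_j = (i == j)%:R.
Proof.
have [_ /andP[/allP e1 e0]] := andP he.
have [<-|] := eqVneq i j; first by apply/eqP/e1/mem_nth; rewrite size_tuple.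
rewrite neq_ltn => /orP[] ij; last rewrite dotC.
  by apply: (pair_ortho_nth e0); rewrite ij size_tuple /=.
by apply: (pair_ortho_nth e0); rewrite ij size_tuple /=.
Qed.

Lemma coord_dot (i : 'I_n) X : coord e i X = g e`_i X.
Proof.
rewrite [X in RHS](coord_basis e_basis) ?memvf // linear_sumr (bigD1 i) //=.
rewrite linearZr_LR /= orthonormal_nth eqxx mulr1 big1 ?addr0 // => j ji.
by rewrite linearZr_LR /= orthonormal_nth eq_sym (negPf ji) mulr0.
Qed.

Lemma dot_expansion X : X = \sum_(i < n) g e`_i X *: e`_i.
Proof.
rewrite {1}(coord_basis e_basis (memvf X)).
by apply: eq_bigr => i _; rewrite coord_dot.
Qed.

Lemma dual_expansion (xi : dual V) X : xi X = \sum_(i < n) g e`_i X * xi e`_i.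
Proof.
by rewrite {1}[X]dot_expansion linear_sum; apply: eq_bigr => i _; rewrite linearZ.
Qed.

Lemma parseval X Y : g X Y = \sum_(i < n) g e`_i X * g e`_i Y.
Proof.
rewrite -flatE dual_expansion; apply: eq_bigr => i _.
by rewrite flatE mulrC (dotC X).
Qed.

(** Expanding B^T e_i turns the trace into a double sum of products g(e_i, A e_j) g(e_i, B e_j).
    Summing over i first is Parseval. *)
Lemma ip_glE A B : ip_gl g A B = \sum_(i < n) g (A e`_i) (B e`_i).
Proof.
rewrite /ip_gl (trace_basis _ e_basis) /=.
transitivity (\sum_(i < n) \sum_(j < n) g e`_i (A e`_j) * g e`_i (B e`_j)).
  apply: eq_bigr => i _; rewrite coord_dot comp_lfunE.
  rewrite [transpose g B _]dot_expansion !linear_sum; apply: eq_bigr => j _.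
  by rewrite !linearZ /= [X in X * _]dotC transposeE mulrC.
by rewrite exchange_big; apply: eq_bigr => j _; rewrite -parseval.
Qed.

Lemma pairing_Gbar (u v : gentan V) : pairing (Gbar g u) v =
  2^-1 * (g u.1 v.1 + \sum_(k < n) u.2 e`_k * v.2 e`_k).
Proof.
rewrite /pairing /Gbar blockE /= add_lfunE !zero_lfunE add0r addr0 flatE; congr (_ * (_ + _)).
rewrite dual_expansion; apply: eq_bigr => k _.
by rewrite dotC dot_sharp.
Qed.

Lemma dual_eq (xi eta : dual V) : (forall k : 'I_n, xi e`_k = eta e`_k) -> xi = eta.
Proof.
move=> E; apply/lfunP => X; rewrite !dual_expansion.
by apply: eq_bigr => k _; rewrite E.
Qed.

Lemma sum_sqr_dot_eq0 (F : 'End(V)) :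
  \sum_(i < n) g (F e`_i) (F e`_i) = 0 -> F = 0.
Proof.
move/eqP; rewrite psumr_eq0 => [|i _]; last exact: dot_ge0.
move=> /allP Fe; apply/lfunP => X.
rewrite [X]dot_expansion linear_sum big1 ?lfunE // => i _.
by rewrite linearZ /= (dot_eq0 (eqP (Fe i (mem_index_enum i)))) scaler0.
Qed.

(** Definiteness is proved for all bilinear forms, not only the alternating ones, because [riesz] is
    applied on the whole space ['Hom(V, dual V)]. *)
Lemma ip_form2_eq0 (a : 'Hom(V, dual V)) :
  ip_form2 e (fun X => a X) (fun X => a X) = 0 -> a = 0.
Proof.
rewrite /ip_form2 pair_big /= => /eqP.
rewrite psumr_eq0 => [/allP ae|[i j] _]; last exact: sqr_ge0.
apply/lfunP => X; rewrite [X]dot_expansion linear_sum big1 ?lfunE // => i _.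
rewrite linearZ /= (_ : a e`_i = 0) ?scaler0 //.
apply: dual_eq => j; rewrite lfunE.
by have := ae (i, j) (mem_index_enum _); rewrite /= mulf_eq0 orbb => /eqP.
Qed.

Lemma Theta2E (L : 'End(gentan V)) D u v Z : (Theta L D u v).2 Z =
  (L (D u v)).2 Z - (D (L u) v).2 Z - (D u (L v)).2 Z :> R.
Proof. by rewrite /Theta /= !(add_lfunE, opp_lfunE). Qed.

(** * Multilinearity of the bracket and the 3-form; the Dorfman bracket *)

Section Bracket.
Variables (mu : V -> V -> V) (H : V -> V -> V -> R).
Hypothesis mu_bil : bilinear_for *:%R *:%R mu.
Hypothesis H_form : three_form H.

Lemma muPl a X1 X2 Y : mu (a *: X1 + X2) Y = a *: mu X1 Y + mu X2 Y.
Proof. exact: mu_bil.1. Qed.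

Lemma muPr a X Y1 Y2 : mu X (a *: Y1 + Y2) = a *: mu X Y1 + mu X Y2.
Proof. exact: mu_bil.2. Qed.

Lemma mu0l X : mu 0 X = 0.
Proof. by have /eqP := muPl 1 0 0 X; rewrite scaler0 addr0 scale1r -subr_eq0 opprD addNKr oppr_eq0 => /eqP. Qed.

Lemma mu0r X : mu X 0 = 0.
Proof. by have /eqP := muPr 1 X 0 0; rewrite scaler0 addr0 scale1r -subr_eq0 opprD addNKr oppr_eq0 => /eqP. Qed.

Lemma HP1 a X1 X2 Y Z : H (a *: X1 + X2) Y Z = a * H X1 Y Z + H X2 Y Z.
Proof. by case: H_form => _ H1 _ _; exact: (H1 Y Z). Qed.

Lemma HP2 a X Y1 Y2 Z : H X (a *: Y1 + Y2) Z = a * H X Y1 Z + H X Y2 Z.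
Proof. by case: H_form => H23 _ _ _; exact: (H23 X).1. Qed.

Lemma HP3 X Y : linear_for *%R (H X Y).
Proof. by case: H_form => H23 _ _ _; exact: (H23 X).2. Qed.

Lemma HD1 X1 X2 Y Z : H (X1 + X2) Y Z = H X1 Y Z + H X2 Y Z.
Proof. by rewrite -{1}[X1]scale1r HP1 mul1r. Qed.

Lemma HD2 X Y1 Y2 Z : H X (Y1 + Y2) Z = H X Y1 Z + H X Y2 Z.
Proof. by rewrite -{1}[Y1]scale1r HP2 mul1r. Qed.

Lemma HD3 X Y Z1 Z2 : H X Y (Z1 + Z2) = H X Y Z1 + H X Y Z2.
Proof. by rewrite -{1}[Z1]scale1r HP3 mul1r. Qed.

Lemma H01 Y Z : H 0 Y Z = 0.
Proof. by apply: (addrI (H 0 Y Z)); rewrite -HD1 !addr0. Qed.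

Lemma H02 X Z : H X 0 Z = 0.
Proof. by apply: (addrI (H X 0 Z)); rewrite -HD2 !addr0. Qed.

Lemma Hswap12 X Y Z : H X Y Z = - H Y X Z.
Proof.
case: H_form => _ _ H0 _; apply/eqP; rewrite -addr_eq0 addrC; apply/eqP.
by have := H0 (X + Y) Z; rewrite HD1 !HD2 !H0 add0r addr0 addrC.
Qed.

Lemma Hswap23 X Y Z : H X Y Z = - H X Z Y.
Proof.
case: H_form => _ _ _ H0; apply/eqP; rewrite -addr_eq0 addrC; apply/eqP.
by have := H0 X (Y + Z); rewrite HD2 !HD3 !H0 add0r addr0 addrC.
Qed.

Lemma dorfman2_linear (u v : gentan V) : linear_for *%R
  (fun Z => - v.2 (mu u.1 Z) + u.2 (mu v.1 Z) + H u.1 v.1 Z).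
Proof. move=> a Z1 Z2; rewrite !muPr HP3 !dualP /=; ring. Qed.

Lemma dorfman2E (u v : gentan V) Z : (dorfman mu H u v).2 Z =
  - v.2 (mu u.1 Z) + u.2 (mu v.1 Z) + H u.1 v.1 Z.
Proof. exact: (dualfunE (dorfman2_linear u v)). Qed.

Lemma part_g_dorfman : part_g (dorfman mu H) = mu.
Proof. by []. Qed.

Lemma part_L3_dorfman : part_L3 (dorfman mu H) = H.
Proof.
apply/funext => X; apply/funext => Y; apply/funext => Z.
by rewrite /part_L3 dorfman2E /= !zero_lfunE oppr0 !add0r.
Qed.

Lemma two_formN (a : 'Hom(V, dual V)) : two_form a -> forall X Y, a X Y = - a Y X.
Proof.
move=> a0 X Y; apply/eqP; rewrite -addr_eq0; apply/eqP.
by have := a0 (X + Y); rewrite [a (X + Y)]linearD add_lfunE !linearD /= !a0 add0r addr0.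
Qed.

(** * The infinitesimal action of l on a Dorfman bracket *)

Section Theta.
Variables (A : 'End(V)) (a : 'Hom(V, dual V)).
Hypothesis a_form : two_form a.

Local Notation L := (block A 0 a (- dual_map A) : 'End(gentan V)).
(* [dorfman mu H] is abstracted, lest simplification expose its [linfun]. *)
Variable D : gentan V -> gentan V -> gentan V.
Hypothesis D1 : forall u v, (D u v).1 = mu u.1 v.1.
Hypothesis D2 : forall u v Z, (D u v).2 Z =
  - v.2 (mu u.1 Z) + u.2 (mu v.1 Z) + H u.1 v.1 Z.

Lemma Theta_vec X Y : (Theta L D (X, 0) (Y, 0)).1 = theta A mu X Y.
Proof. by rewrite /Theta /theta !blockE /= !D1 /= !zero_lfunE !addr0. Qed.

(** The endomorphism [A] acts on H as on any 3-form. The 2-form [a] enters through three terms,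
    which its antisymmetry rearranges into minus its differential. This is the only component of the
    action where [a] appears. *)
Lemma Theta_vec2 X Y Z : (Theta L D (X, 0) (Y, 0)).2 Z =
  - CE2 mu a X Y Z - H (A X) Y Z - H X (A Y) Z - H X Y (A Z).
Proof.
rewrite Theta2E !blockE /= !linear0 !addr0.
rewrite !D2 D1 /= add_lfunE !opp_lfunE dual_mapE D2 /= !zero_lfunE.
rewrite /CE2 (two_formN a_form (mu X Z)) (two_formN a_form (mu Y Z)).
ring.
Qed.

Lemma Theta_mixed X xi : (Theta L D (X, 0) (0, xi)).1 = 0.
Proof.
rewrite /Theta !blockE /= !D1 /= !zero_lfunE.
by rewrite !mu0r !linear0 !addr0 mu0r !subr0.
Qed.

(** The mixed part of D is minus the transpose of mu(X, .), so the action on it repeats the action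
    of [A] on mu. *)
Lemma Theta_mixed2 X xi Z :
  (Theta L D (X, 0) (0, xi)).2 Z = - xi (theta A mu X Z).
Proof.
rewrite Theta2E !blockE /= !linear0 !addr0.
rewrite !D2 D1 /= mu0r linear0 !add0r !opp_lfunE !dual_mapE D2 /=.
rewrite !zero_lfunE !addr0 mu0l linear0 !H02 !addr0 /theta !dualB.
ring.
Qed.

Lemma dorfman_covec xi eta : D (0, xi) (0, eta) = 0.
Proof.
apply: injective_projections; rewrite /= ?D1 /= ?mu0l //.
by apply/lfunP => Z; rewrite D2 /= !mu0l !linear0 H01 zero_lfunE !addr0.
Qed.

Lemma sum3_cycle (F : 'I_n -> 'I_n -> 'I_n -> R) :
  \sum_i \sum_j \sum_k F j k i = \sum_i \sum_j \sum_k F i j k.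
Proof.
rewrite exchange_big; apply: eq_bigr => j _; exact: exchange_big.
Qed.

(** The vector-vector sum, of weight 2, gives one copy of the mu-term and both H-terms. The mixed
    sum, of weight 4, gives two more copies of the mu-term, whence its coefficient 3. The
    covector-covector sum vanishes with D. The coefficient 3 of the last term counts the three slots
    of H on which [A] acts. *)
Lemma ip_dorfman_Theta : ip_dorfman g e (Theta L D) D =
  3 * ip_bracket g e (theta A mu) mu - ip_form3 e (CE2 mu a) H
  - 3 * ip_form3 e (fun X => H (A X)) H.
Proof.
have Hcyc X Y Z : H X Y Z = H Z X Y by rewrite Hswap23 Hswap12 opprK.
pose S (F : V -> V -> V -> R) := \sum_(i < n) \sum_(j < n) \sum_(k < n) F e`_i e`_j e`_k.
have SE F G : (forall X Y Z, F X Y Z = G X Y Z) -> S F = S G.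
  by move=> FG; rewrite /S; do 3!(apply: eq_bigr => ? _); rewrite FG.
have SN F : S (fun X Y Z => - F X Y Z) = - S F.
  by rewrite /S -sumrN; apply: eq_bigr => i _; rewrite -sumrN;
    apply: eq_bigr => j _; rewrite -sumrN.
have SB F G : S (fun X Y Z => F X Y Z - G X Y Z) = S F - S G.
  by rewrite -SN /S -big_split; apply: eq_bigr => i _; rewrite -big_split;
    apply: eq_bigr => j _; rewrite -big_split.
have Scyc F : S (fun X Y Z => F Y Z X) = S F.
  exact: (sum3_cycle (fun i j k => F e`_i e`_j e`_k)).
(* H is invariant under cyclic permutations, so a cyclic shift of the summation indices moves [A]
   from one slot to another. *)
have S2 : S (fun X Y Z => H X (A Y) Z * H X Y Z) = S (fun X Y Z => H (A X) Y Z * H X Y Z).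
  by rewrite -[RHS]Scyc; apply: SE => X Y Z; rewrite (Hcyc (A Y)) (Hcyc Y).
have S3 : S (fun X Y Z => H X Y (A Z) * H X Y Z) = S (fun X Y Z => H (A X) Y Z * H X Y Z).
  by rewrite -[RHS]Scyc -[RHS]Scyc; apply: SE => X Y Z; rewrite (Hcyc X Y (A Z)) (Hcyc X Y Z).
have form_a : ip_form3 e (CE2 mu a) H = S (fun X Y Z => CE2 mu a X Y Z * H X Y Z) by [].
have form_A : ip_form3 e (fun X => H (A X)) H = S (fun X Y Z => H (A X) Y Z * H X Y Z) by [].
have vec : \sum_(i < n) \sum_(j < n)
    pairing (Gbar g (Theta L D (evec e i) (evec e j))) (D (evec e i) (evec e j)) =
  2^-1 * (ip_bracket g e (theta A mu) mu - ip_form3 e (CE2 mu a) H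
  - 3 * ip_form3 e (fun X => H (A X)) H).
  transitivity (2^-1 * (ip_bracket g e (theta A mu) mu + S (fun X Y Z =>
    (- CE2 mu a X Y Z - H (A X) Y Z - H X (A Y) Z - H X Y (A Z)) * H X Y Z))).
    rewrite /ip_bracket -big_split mulr_sumr; apply: eq_bigr => i _.
    rewrite -big_split mulr_sumr; apply: eq_bigr => j _.
    rewrite pairing_Gbar /evec Theta_vec D1; congr (_ * (_ + _)).
    by apply: eq_bigr => k _; rewrite Theta_vec2 D2 /= !zero_lfunE oppr0 !add0r.
  congr (_ * _). rewrite (SE _ (fun X Y Z => - (CE2 mu a X Y Z * H X Y Z)
    - H (A X) Y Z * H X Y Z - H X (A Y) Z * H X Y Z - H X Y (A Z) * H X Y Z)).
    rewrite !SB SN S2 S3 form_a form_A.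
    by ring.
  by move=> X Y Z; ring.
have mixed : \sum_(i < n) \sum_(j < n)
    pairing (Gbar g (Theta L D (evec e i) (ecov e j))) (D (evec e i) (ecov e j)) =
  2^-1 * ip_bracket g e (theta A mu) mu.
  rewrite mulr_sumr; apply: eq_bigr => i _.
  transitivity (\sum_(j < n) \sum_(k < n)
      2^-1 * (g e`_j (theta A mu e`_i e`_k) * g e`_j (mu e`_i e`_k))).
    apply: eq_bigr => j _; rewrite pairing_Gbar Theta_mixed linear0l add0r mulr_sumr.
    apply: eq_bigr => k _; rewrite Theta_mixed2 D2 /= mu0l linear0 H02 !addr0.
    by rewrite !lfunE /= !coord_dot mulrNN.
  (* For fixed i and k, the sum over j is Parseval for the vectors theta(A) mu(e_i, e_k) and mu(e_i,
     e_k). *)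
  rewrite exchange_big mulr_sumr; apply: eq_bigr => k _.
  by rewrite -mulr_sumr -parseval.
rewrite /ip_dorfman vec mixed big1 => [|i _]; last first.
  rewrite big1 // => j _; rewrite pairing_Gbar dorfman_covec linear0r add0r.
  by rewrite big1 ?mulr0 // => k _; rewrite zero_lfunE mulr0.
by field.
Qed.

End Theta.

(** * The codifferential and the two moment maps *)

Lemma ip_form2_linear_l (b : V -> V -> R) :
  linear_for *%R (fun a : 'Hom(V, dual V) => ip_form2 e (fun X => a X) b).
Proof.
move=> k a1 a2; rewrite /ip_form2 mulr_sumr -big_split; apply: eq_bigr => i _.
rewrite mulr_sumr -big_split; apply: eq_bigr => j _ /=.
by rewrite !(add_lfunE, scale_lfunE) mulrDl mulrA.
Qed.

Lemma ip_form2C (a b : V -> V -> R) : ip_form2 e a b = ip_form2 e b a.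
Proof. by apply: eq_bigr => i _; apply: eq_bigr => j _; rewrite mulrC. Qed.

Lemma ip_form2_linear_r (a : V -> V -> R) :
  linear_for *%R (fun b : 'Hom(V, dual V) => ip_form2 e a (fun X => b X)).
Proof. by move=> k b1 b2; rewrite !(ip_form2C a) ip_form2_linear_l. Qed.

Lemma ip_form3_CE2_linear :
  linear_for *%R (fun a : 'Hom(V, dual V) => ip_form3 e (CE2 mu a) H).
Proof.
move=> k a1 a2; rewrite /ip_form3 mulr_sumr -big_split; apply: eq_bigr => i _.
rewrite mulr_sumr -big_split; apply: eq_bigr => j _.
rewrite mulr_sumr -big_split; apply: eq_bigr => l _ /=.
by rewrite /CE2 !(add_lfunE, scale_lfunE) /GRing.scale /=; ring.
Qed.

(** It suffices to exhibit one 2-form with the defining property, as [xget] then selects such a form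
    instead of its default 0. *)
Lemma codiffP : two_form (codiff e mu H) /\ forall a : 'Hom(V, dual V),
  two_form a -> ip_form2 e (fun X => a X) (fun X => codiff e mu H X)
                = ip_form3 e (CE2 mu a) H.
Proof.
apply: (@xgetPex _ 0 [set b | two_form b /\ forall a : 'Hom(V, dual V),
  two_form a -> ip_form2 e (fun X => a X) (fun X => b X)
                = ip_form3 e (CE2 mu a) H]%classic).
have [x xE] : exists x : 'Hom(V, dual V), forall a : 'Hom(V, dual V),
    ip_form2 e (fun X => x X) (fun X => a X) = ip_form3 e (CE2 mu a) H.
  apply: riesz ip_form3_CE2_linear => [b|a|].
  - exact: (ip_form2_linear_l (fun X => b X)).
  - exact: (ip_form2_linear_r (fun X => a X)).
  - exact: ip_form2_eq0.
(* The Riesz representative [x] need not be alternating. Its skew part (x - x^t)/2 is a 2-form and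
   has the same inner products with 2-forms as [x]. *)
pose xt : 'Hom(V, dual V) := linfun (fun X => linfun (fun Y => x Y X : R^o)).
have lin_x X : linear_for *%R (fun Y => x Y X : R).
  by move=> k Y1 Y2; rewrite linearP add_lfunE scale_lfunE.
have xtE X Y : xt X Y = x Y X.
  rewrite /xt linfunE ?(dualfunE (lin_x X)) // => k X1 X2; apply/lfunP => Z.
  by rewrite add_lfunE scale_lfunE !(dualfunE (lin_x _)) dualP.
have bE X Y : (2^-1 *: (x - xt)) X Y = 2^-1 * (x X Y - x Y X) :> R.
  by rewrite !(scale_lfunE, add_lfunE, opp_lfunE) xtE.
exists (2^-1 *: (x - xt)); split=> [X | a a_form]; first by rewrite bE subrr mulr0.
rewrite -xE ip_form2C.
have E : \sum_(i < n) \sum_(j < n) x e`_j e`_i * a e`_i e`_j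
    = - ip_form2 e (fun X => x X) (fun X => a X).
  rewrite exchange_big -sumrN; apply: eq_bigr => i _; rewrite -sumrN.
  by apply: eq_bigr => j _; rewrite (two_formN a_form) mulrN.
transitivity (2^-1 * (ip_form2 e (fun X => x X) (fun X => a X)
    - \sum_(i < n) \sum_(j < n) x e`_j e`_i * a e`_i e`_j)); last first.
  by rewrite E; field.
rewrite -sumrB mulr_sumr; apply: eq_bigr => i _.
by rewrite -sumrB mulr_sumr; apply: eq_bigr => j _; rewrite bE; ring.
Qed.

Lemma ip_form2Bl (a b c : 'Hom(V, dual V)) :
  ip_form2 e (fun X => (a - b) X) (fun X => c X) =
  ip_form2 e (fun X => a X) (fun X => c X) - ip_form2 e (fun X => b X) (fun X => c X).
Proof.
have := ip_form2_linear_l (fun X => c X) (-1) b a.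
by rewrite scaleN1r (addrC (- b)) mulN1r => ->; rewrite addrC.
Qed.

Lemma ip_form2_ge0 (a : 'Hom(V, dual V)) :
  0 <= ip_form2 e (fun X => a X) (fun X => a X).
Proof. by do 2!apply: sumr_ge0 => ? _; exact: sqr_ge0. Qed.

Lemma ip_glBl A B C : ip_gl g (A - B) C = ip_gl g A C - ip_gl g B C.
Proof.
rewrite !ip_glE -sumrB; apply: eq_bigr => i _.
by rewrite add_lfunE opp_lfunE linearDl linearNl.
Qed.

Lemma ip_gl_ge0 A : 0 <= ip_gl g A A.
Proof. by rewrite ip_glE; apply: sumr_ge0 => i _; apply: dot_ge0. Qed.

(** By [riesz], since the trace form is definite and theta(A) mu is linear in A. *)
Lemma momentP A :
  ip_gl g (moment g e mu) A = 4^-1 * ip_bracket g e (theta A mu) mu.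
Proof.
move: A; apply: (@xgetPex _ 0 [set M | forall A : 'End(V),
    ip_gl g M A = 4^-1 * ip_bracket g e (theta A mu) mu]%classic).
apply: riesz => [A k F G|F k A1 A2|F|k A1 A2].
- rewrite !ip_glE mulr_sumr -big_split; apply: eq_bigr => i _ /=.
  by rewrite add_lfunE scale_lfunE dotPl.
- rewrite !ip_glE mulr_sumr -big_split; apply: eq_bigr => i _ /=.
  by rewrite add_lfunE scale_lfunE dot_linear.
- by rewrite ip_glE; apply: sum_sqr_dot_eq0.
rewrite mulrCA -mulrDr; congr (_ * _).
rewrite mulr_sumr -big_split; apply: eq_bigr => i _ /=.
rewrite mulr_sumr -big_split; apply: eq_bigr => j _ /=.
rewrite -dotPl; congr (g _ _); rewrite /theta !(add_lfunE, scale_lfunE).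
rewrite muPl muPr !scalerBr.
by rewrite !opprD (addrACA (k *: _)) [LHS]addrACA.
Qed.

Lemma lie_l_block (A : 'End(V)) (a : 'Hom(V, dual V)) :
  two_form a -> lie_l (block A 0 a (- dual_map A) : 'End(gentan V)).
Proof. by move=> a_form; rewrite /lie_l blockA_block blockalpha_block. Qed.

Lemma ip_l_block (A A' : 'End(V)) (a a' : 'Hom(V, dual V)) :
  ip_l g e (block A 0 a (- dual_map A)) (block A' 0 a' (- dual_map A')) =
  2 * ip_gl g A A' + 6^-1 * ip_form2 e (fun X => a X) (fun X => a' X).
Proof. by rewrite /ip_l !blockA_block !blockalpha_block. Qed.

Lemma Hsq_linear_r X : linear_for *%R (fun Y => ip_form2 e (H X) (H Y)).
Proof.
move=> k Y1 Y2; rewrite /ip_form2 mulr_sumr -big_split; apply: eq_bigr => j _.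
rewrite mulr_sumr -big_split; apply: eq_bigr => l _ /=.
by rewrite HP1 mulrDr mulrCA.
Qed.

(** Both sides are the sum over i of H^2(e_i, A e_i). Thus g^-1 H^2 represents the last term of
    [ip_dorfman_Theta]. *)
Lemma ip_gl_sharp_Hsq A : ip_gl g (sharp g \o Hsq e H)%VF A =
  ip_form3 e (fun X => H (A X)) H.
Proof.
rewrite ip_glE; apply: eq_bigr => i _.
rewrite comp_lfunE dot_sharp /Hsq linfunE => [|k X1 X2]; last first.
  apply/lfunP => Y; rewrite add_lfunE scale_lfunE !(dualfunE (Hsq_linear_r _)).
  by rewrite !(ip_form2C _ (H Y)); exact: Hsq_linear_r.
by rewrite (dualfunE (Hsq_linear_r _)) ip_form2C.
Qed.

(** After the factor 1/6, the mu-term and the H^2-term have coefficients 1/2 and -1/2. The weight 2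
    of the trace in [ip_l] leaves 1/4, absorbed in the definition of M_mu, and -1/4. The weight 1/6
    on 2-forms cancels the factor 1/6, so the codifferential enters with coefficient -1. *)
Let M0 := moment g e mu - 4^-1 *: (sharp g \o Hsq e H)%VF.

(** The explicit block satisfies the defining property, and positive definiteness of [ip_l] on l
    makes the solution unique. *)
Lemma gmomentE : gmoment g e (dorfman mu H) =
  block M0 0 (- codiff e mu H) (- dual_map M0).
Proof.
have [c_form cE] := codiffP.
have c'_form : two_form (- codiff e mu H).
  by move=> X; rewrite !opp_lfunE c_form oppr0.
pose P : set 'End(gentan V) := [set M | lie_l M /\ forall L, lie_l L ->
    ip_l g e M L = 6^-1 * ip_dorfman g e (Theta L (dorfman mu H)) (dorfman mu H)]%classic.
have P0 : P (block M0 0 (- codiff e mu H) (- dual_map M0)).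
  split=> [|L [a_form ->]]; first exact: lie_l_block.
  rewrite ip_l_block ip_dorfman_Theta //; last exact: dorfman2E.
  have -> : ip_gl g M0 (blockA L) = ip_gl g (moment g e mu) (blockA L)
      - 4^-1 * ip_gl g (sharp g \o Hsq e H)%VF (blockA L).
    rewrite !ip_glE mulr_sumr -sumrB; apply: eq_bigr => i _.
    by rewrite /M0 add_lfunE opp_lfunE scale_lfunE addrC -scaleNr dotPl mulNr addrC.
  rewrite momentP ip_gl_sharp_Hsq -cE //.
  have -> : ip_form2 e (fun X => (- codiff e mu H) X) (fun X => blockalpha L X)
      = - ip_form2 e (fun X => blockalpha L X) (fun X => codiff e mu H X).
    rewrite ip_form2C -sumrN; apply: eq_bigr => i _; rewrite -sumrN.
    by apply: eq_bigr => j _; rewrite !opp_lfunE mulrN.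
  by field.
(* The set [P] is inhabited, so the moment map belongs to it. What follows shows that any two
   elements of [P] coincide. *)
have : P (gmoment g e (dorfman mu H)) := xgetI 0 P0.
move: (gmoment _ _ _) (M0) (- codiff e mu H) P0 c'_form => L M c' P0 c'_form.
move=> [[a_form LE] P1].
move: (blockA L) (blockalpha L) a_form LE P1 => A a a_form -> P1.
have d_form : two_form (a - c').
  by move=> X; rewrite !add_lfunE !opp_lfunE a_form c'_form subrr.
(* The difference of the two solutions lies in l and is tested against itself. Its squared norm is
   then a vanishing sum of two nonnegative terms, so both blocks of the difference are zero. *)
have := P1 _ (lie_l_block (A - M) d_form).
rewrite -(P0.2 _ (lie_l_block (A - M) d_form)) !ip_l_block.
move/eqP; rewrite -subr_eq0 opprD addrACA -!mulrBr -ip_glBl -ip_form2Bl.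
rewrite paddr_eq0 ?mulr_ge0 ?ip_gl_ge0 ?ip_form2_ge0 ?invr_ge0 ?ler0n //.
rewrite !mulf_eq0 !invr_eq0 !pnatr_eq0 /= => /andP[/eqP A0 /eqP a0].
rewrite ip_glE in A0.
move/sum_sqr_dot_eq0/eqP: A0; rewrite subr_eq0 => /eqP ->.
by move/ip_form2_eq0/eqP: a0; rewrite subr_eq0 => /eqP ->.
Qed.

End Bracket.
End Orthonormal.
End Metric.
End LinearAlgebra.

Theorem proposition4p13 (R : realType) (V : vectType R) (g : {dot V for idfun})
    (n : nat) (e : n.-tuple V) (he : orthonormal_basis g e)
    (bmu : gentan V -> gentan V -> gentan V) (hbmu : Dbrackets bmu) :
  exists A : 'End(gentan V),
    [/\ so_Gbar g A, so_pairing A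
      & gRic g e bmu =
          gmoment g e bmu + overline (Ric g (part_g bmu))
          - overline (moment g e (part_g bmu)) + A].
Proof.
have [mu [H [[mu_bil _ _] H_form _ ->]]] := hbmu.
have [c_form _] := codiffP he mu H.
set c := codiff e mu H in c_form.
have cN := two_formN c_form.
(* The lower-left block is -c/2 in the generalized Ricci curvature and -c in the moment map, so
   their difference is c/2. The upper-right block comes from the Ricci side alone. *)
exists (block 0 (2^-1 *: (sharp g \o c \o sharp g)%VF) (2^-1 *: c) 0); split.
- move=> u v; rewrite !pairing_Gbar_sharp !blockE /= !zero_lfunE !add0r !addr0.
  rewrite !scale_lfunE !comp_lfunE [in RHS]dotC [in X in _ = - (_ * (_ + X))]dotC.
  rewrite !linearZ /= !linearZl_LR /= !dot_sharp.
  rewrite (cN v.1) (cN u.1); ring.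
(* Symmetry of [sharp] turns the covector part into c(g^-1 u.2, g^-1 v.2). Both parts then change
   sign when u and v are exchanged. *)
- move=> u v; rewrite /pairing !blockE /= !zero_lfunE !add0r !addr0.
  rewrite !scale_lfunE !comp_lfunE !linearZ /= /GRing.scale /=.
  rewrite !(sharpC g _ (c _)) (cN v.1) (cN (sharp g v.2)); ring.
rewrite (gmomentE he mu_bil H_form) /gRic part_g_dorfman (part_L3_dorfman mu_bil H_form) -/c.
rewrite /overline !blockN !blockD !oppr0 !addr0 add0r.
(* Used with M the moment map of mu and S = g^-1 H^2 / 4, on the upper-left block and, through
   [dual_map], on the lower-right one. *)
have RicE (Rc M S : 'End(V)) : Rc - S = M - S + Rc - M.
  by rewrite [RHS]addrAC (addrAC M) subrr add0r addrC.
congr block; first exact: RicE.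
  by rewrite -scaleN1r -[- c]scaleN1r scalerA -scalerDl; congr (_ *: _); field.
by rewrite -!dual_mapN -!dual_mapD -!opprD -RicE.
Qed.
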